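(* Let $S = R \cup B$ be a set of $2n$ points in general position (no three collinear) in the plane with $|R| = |B| = n$ (red points $R$, blue points $B$), such that $R$ and $B$ are linearly separable. Then $S$ has at least $\frac{2n^2+3n-8}{12}$ balanced $4$-holes.
   Context: A hole of $S$ is a simple polygon with vertices in $S$ and no point of $S$ in its interior (not necessarily convex); a $4$-hole has $4$ vertices and is balanced if it has exactly two red and two blue vertices. $R$ and $B$ are linearly separable if some line has all of $R$ strictly on one side and all of $B$ strictly on the other. *)

(* Defs.v *)
From mathcomp Require Import all_boot all_order all_algebra.
From mathcomp Require Import boolp reals.
Set Implicit Arguments. Unset Strict Implicit. Unset Printing Implicit Defensive.
Import Order.TTheory GRing.Theory Num.Theory.
Local Open Scope ring_scope.

Section Geom.
Variable R : realType.
Definition point := (R * R)%type.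

(* twice the signed area of triangle abc *)
Definition orient (a b c : point) : R :=
  (b.1 - a.1) * (c.2 - a.2) - (b.2 - a.2) * (c.1 - a.1).

Definition collinear (a b c : point) : Prop := orient a b c = 0.

Definition on_seg (p q x : point) : Prop :=
  exists t : R, 0 <= t <= 1 /\ x = (p.1 + t * (q.1 - p.1), p.2 + t * (q.2 - p.2)).

Definition segs_meet (p q p' q' : point) : Prop :=
  exists x, on_seg p q x /\ on_seg p' q' x.

Definition in_open_tri (a b c p : point) : bool :=
  ((0 < orient a b p) && (0 < orient b c p) && (0 < orient c a p)) ||
  ((orient a b p < 0) && (orient b c p < 0) && (orient c a p < 0)).

(* signed contribution of triangle abc to the winding number around p *)
Definition wtri (a b c p : point) : int :=
  if in_open_tri a b c p then sgz (orient a b c) else 0.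

(* winding number of the closed polygon a -> b -> c -> d -> a around p,
   computed by the fan decomposition from a (valid for p not on the
   boundary and not on the diagonal ac) *)
Definition winding4 (a b c d p : point) : int := wtri a b c p + wtri a c d p.

Definition simple_quad (a b c d : point) : Prop :=
  [/\ uniq [:: a; b; c; d],
      ~ segs_meet a b c d, ~ segs_meet b c d a &
      forall x, (on_seg a b x /\ on_seg b c x -> x = b) /\
                (on_seg b c x /\ on_seg c d x -> x = c) /\
                (on_seg c d x /\ on_seg d a x -> x = d) /\
                (on_seg d a x /\ on_seg a b x -> x = a)].

Definition interior_quad (a b c d p : point) : Prop :=
  ~ on_seg a b p /\ ~ on_seg b c p /\ ~ on_seg c d p /\ ~ on_seg d a p /\
  winding4 a b c d p <> 0.
End Geom.

Definition cidx (n : nat) : finType := ('I_n + 'I_n)%type.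

Definition is_red n (i : cidx n) : bool := if i is inl _ then true else false.

Section Holes.
Variables (R : realType) (n : nat) (pt : cidx n -> point R).

Definition general_position : Prop :=
  forall i j k : cidx n, i <> j -> j <> k -> i <> k -> ~ collinear (pt i) (pt j) (pt k).

Definition lin_separable : Prop :=
  exists a b c : R, (a != 0 \/ b != 0) /\
    (forall i, is_red i -> 0 < a * (pt i).1 + b * (pt i).2 + c) /\
    (forall i, ~~ is_red i -> a * (pt i).1 + b * (pt i).2 + c < 0).

Definition balanced_4hole (i0 i1 i2 i3 : cidx n) : Prop :=
  [/\ uniq [:: i0; i1; i2; i3],
      simple_quad (pt i0) (pt i1) (pt i2) (pt i3),
      (forall k, ~ interior_quad (pt i0) (pt i1) (pt i2) (pt i3) (pt k)) &
      count (@is_red n) [:: i0; i1; i2; i3] = 2%N].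

(* a 4-gon is identified with its set of edges (this identifies the 8
   vertex sequences obtained by rotation and reversal) *)
Definition quad_edges (i0 i1 i2 i3 : cidx n) : {set {set cidx n}} :=
  [set [set i0; i1]; [set i1; i2]; [set i2; i3]; [set i3; i0]].

Definition balanced_4holes : {set {set {set cidx n}}} :=
  [set E | [exists t : cidx n * cidx n * cidx n * cidx n,
     `[< balanced_4hole t.1.1.1 t.1.1.2 t.1.2 t.2 >] &&
     (E == quad_edges t.1.1.1 t.1.1.2 t.1.2 t.2)]].
End Holes.

(* Main.v *)
(* Let (r, b) be a red-blue pair. It is good if the open half-plane L(r, b) on
   the left of the ray from r to b contains points of both colours. At most n
   pairs have no blue point on their left, at most n have no red one, and the
   pair whose line crosses the separating line at the extreme point has neither;
   so there are at least (n-1)^2 good pairs.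

   For a good pair let b' be the blue point following b around r in L(r, b) and
   r' the red point following r around b. The triangle r b b' contains only red
   points, and r b r' only blue ones. If one of these triangles contains exactly
   one point, that point and the triangle form a non-convex balanced 4-hole. If
   both are empty, the points p of L(r, b) with r b p empty form a staircase
   with the blue points first and the red ones last; the blue and the red point
   adjacent at the colour change form a convex hole with r and b. In each case
   (r, b) is the unique red-blue pair of the four vertices with the other two
   on its left, so distinct pairs give distinct holes.

   There remain the pairs whose triangle r b b' (or r b r') contains at least two
   points. For fixed r the cones r b b' are disjoint, and every red point of the
   triangle is closer to the separating line than r, so at most n(n-1)/4 pairs
   are lost for each colour. Altogether there are at least
   (n-1)^2 - 2 floor(n(n-1)/4) holes. *)
Require Import Defs.
From mathcomp Require Import all_boot all_order all_algebra.
From mathcomp Require Import boolp reals.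
From mathcomp Require Import ring lra zify.
Import Order.TTheory GRing.Theory Num.Theory.
Set Implicit Arguments. Unset Strict Implicit. Unset Printing Implicit Defensive.
Local Open Scope ring_scope.

(** * Orientation determinants, triangles and simple quadrilaterals *)

Section Orientation.
Variable R : realType.
Implicit Types a b c d p q w x : point R.

Lemma orient_rot a b c : orient b c a = orient a b c.
Proof. by rewrite /orient; ring. Qed.

Lemma orient_swap a b c : orient b a c = - orient a b c.
Proof. by rewrite /orient; ring. Qed.

Lemma orient_swapr a b c : orient a c b = - orient a b c.
Proof. by rewrite /orient; ring. Qed.

Lemma orient_id12 a b : orient a a b = 0.
Proof. by rewrite /orient; ring. Qed.

Lemma orient_id13 a b : orient a b a = 0.
Proof. by rewrite /orient; ring. Qed.

Lemma orient_id23 a b : orient a b b = 0.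
Proof. by rewrite /orient; ring. Qed.

Lemma orient_split a b c w :
  orient a b w + orient b c w + orient c a w = orient a b c.
Proof. by rewrite /orient; ring. Qed.

Lemma orient_barycentric a b c p q w :
  orient a b c * orient p q w =
  orient b c w * orient p q a + orient c a w * orient p q b
  + orient a b w * orient p q c.
Proof. by rewrite /orient; ring. Qed.

Definition in_ccw_tri a b c w :=
  [&& 0 < orient a b w, 0 < orient b c w & 0 < orient c a w].

Lemma in_ccw_tri_gt0 a b c w : in_ccw_tri a b c w -> 0 < orient a b c.
Proof. by case/and3P=> ? ? ?; rewrite -(orient_split _ _ _ w); lra. Qed.

Lemma in_open_triE a b c w :
  0 < orient a b c -> in_open_tri a b c w = in_ccw_tri a b c w.
Proof.
move=> abc0; rewrite /in_open_tri /in_ccw_tri -andbA.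
case: and3P => //= _; apply/negP => /andP[/andP[? ?] ?].
by move: (orient_split a b c w); lra.
Qed.

(** By [orient_barycentric], [w] has positive barycentric coordinates in [abc], and [orient p q] is
    affine. *)
Lemma in_ccw_tri_orient a b c p q w : in_ccw_tri a b c w ->
  0 <= orient p q a -> 0 <= orient p q b -> 0 <= orient p q c ->
  0 < orient p q a + orient p q b + orient p q c -> 0 < orient p q w.
Proof.
move=> abcw pa pb pc psum; have abc0 := in_ccw_tri_gt0 abcw.
rewrite -(pmulr_rgt0 _ abc0) orient_barycentric.
case/and3P: abcw => wab wbc wca.
have := mulr_ge0 (ltW wbc) pa; have := mulr_ge0 (ltW wca) pb.
have := mulr_ge0 (ltW wab) pc.
have [a0|a0] := ltrP 0 (orient p q a).
  by have := mulr_gt0 wbc a0; lra.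
have [b0|b0] := ltrP 0 (orient p q b).
  by have := mulr_gt0 wca b0; lra.
have c0 : 0 < orient p q c by lra.
by have := mulr_gt0 wab c0; lra.
Qed.

Lemma orient_on_seg p q a b x : on_seg a b x -> exists2 t, 0 <= t <= 1 &
  x = (a.1 + t * (b.1 - a.1), a.2 + t * (b.2 - a.2)) /\
  orient p q x = (1 - t) * orient p q a + t * orient p q b.
Proof.
by case=> t [t01 ->]; exists t => //; split=> //; rewrite /orient /=; ring.
Qed.

(** The line [pq] weakly separates the segments, and each touches it at most in its first
    endpoint. *)
Lemma segs_opposite_meet p q a b c d x :
  0 <= orient p q a -> 0 < orient p q b ->
  orient p q c <= 0 -> orient p q d < 0 ->
  on_seg a b x -> on_seg c d x -> x = a /\ x = c.
Proof.
move=> pa pb pc pd /(orient_on_seg p q)[t /andP[t0 t1] [xE tE]].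
case/(orient_on_seg p q)=> s /andP[s0 s1] [xE' sE].
have h1 : 0 <= (1 - t) * orient p q a by apply: mulr_ge0 => //; lra.
have h2 : 0 <= t * orient p q b by apply: mulr_ge0 => //; lra.
have h3 : (1 - s) * orient p q c <= 0 by apply: mulr_ge0_le0 => //; lra.
have h4 : s * orient p q d <= 0 by apply: mulr_ge0_le0 => //; lra.
have /eqP : t * orient p q b = 0 by lra.
have /eqP : s * orient p q d = 0 by lra.
rewrite !mulf_eq0 (gt_eqF pb) (lt_eqF pd) !orbF => /eqP sz /eqP tz.
split; [rewrite xE tz | rewrite xE' sz]; rewrite !mul0r !addr0;
  by [case: (a) | case: (c)].
Qed.

Lemma on_segC a b x : on_seg a b x -> on_seg b a x.
Proof.
case=> t [/andP[t0 t1] ->]; exists (1 - t); split; first by apply/andP; lra.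
by congr pair; ring.
Qed.

Lemma segs_share_endpoint a b c x :
  orient a b c != 0 -> on_seg a b x -> on_seg b c x -> x = b.
Proof.
move=> abc0 /(orient_on_seg b c)[t _ [xE tE]].
case/(orient_on_seg b c)=> s _ [_ sE].
have /eqP : (1 - t) * orient b c a = 0.
  by move: tE sE; rewrite orient_id13 orient_id23; lra.
rewrite mulf_eq0 (orient_rot a b c) (negPf abc0) orbF subr_eq0 => /eqP t1.
by rewrite xE -t1 !mul1r; case: (b) => b1 b2 /=; congr pair; ring.
Qed.

(** The diagonal [ac] strictly separates [b] from [d], so sides on different sides of it meet at
    most in [a] or [c]. Reflex quadrilaterals are covered too. *)
Lemma simple_quad_diag a b c d :
  orient a c b < 0 -> 0 < orient a c d -> simple_quad a b c d.
Proof.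
move=> acb acd.
have ab : a <> b by move=> e; move: acb; rewrite -e orient_id13 ltxx.
have ac : a <> c by move=> e; move: acb; rewrite -e orient_id12 ltxx.
have ad : a <> d by move=> e; move: acd; rewrite -e orient_id13 ltxx.
have bc : b <> c by move=> e; move: acb; rewrite e orient_id23 ltxx.
have bd : b <> d by move=> e; move: acb acd; rewrite -e; lra.
have cd : c <> d by move=> e; move: acd; rewrite e orient_id23 ltxx.
have a0 : 0 <= orient a c a by rewrite orient_id13.
have a0' : orient a c a <= 0 by rewrite orient_id13.
have c0 : 0 <= orient a c c by rewrite orient_id23.
have c0' : orient a c c <= 0 by rewrite orient_id23.
split.
- by rewrite /= !inE !negb_or; do ! [apply/andP; split]; apply/eqP.
- move=> [x [xab xcd]].
  by have [? ?] := segs_opposite_meet c0 acd a0' acb xcd xab; congruence.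
- move=> [x [/on_segC xbc /on_segC xda]].
  by have [? ?] := segs_opposite_meet a0 acd c0' acb xda xbc; congruence.
- move=> x; split; [|split; [|split]] => -[x1 x2].
  + apply: segs_share_endpoint x1 x2; rewrite -oppr_eq0 -orient_swapr.
    by rewrite lt_eqF.
  + by have [] := segs_opposite_meet c0 acd c0' acb x2 (on_segC x1).
  + apply: segs_share_endpoint x1 x2.
    by rewrite -orient_rot orient_rot orient_rot gt_eqF // -orient_rot.
  + by have [] := segs_opposite_meet a0 acd a0' acb (on_segC x1) x2.
Qed.

Lemma interior_quad_tri a b c d p : interior_quad a b c d p ->
  in_open_tri a b c p \/ in_open_tri a c d p.
Proof.
case=> _ [_] [_] [_]; rewrite /winding4 /wtri.
by do 2 case: in_open_tri; [left|left|right|].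
Qed.

End Orientation.

(** * Double counting on index sets *)

Section Counting.
Local Open Scope nat_scope.

Lemma card_le_rel (T1 T2 : finType) (A : {set T1}) (B : {set T2})
    (P : T1 -> T2 -> Prop) :
  (forall x, x \in A -> exists2 y, y \in B & P x y) ->
  (forall x x' y, P x y -> P x' y -> x = x') -> #|A| <= #|B|.
Proof.
move=> Pex Pinj; pose f x := [pick y in B | `[< P x y >]].
have fP x : x \in A -> exists2 y, f x = Some y & y \in B /\ P x y.
  move=> /Pex[y yB Pxy]; rewrite /f.
  case: pickP => [z /andP[zB /asboolP Pxz]|/(_ y)]; first by exists z.
  by rewrite yB (asboolT Pxy).
have fI : {in A &, injective f}.
  move=> x x' /fP[y -> [_ Pxy]] /fP[y' -> [_ Px'y]] [yy'].
  by apply: (Pinj _ _ y Pxy); rewrite yy'.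
have SomeI : injective (@Some T2) by move=> ? ? [].
rewrite -(card_in_imset fI) -(card_imset (mem B) SomeI).
by apply/subset_leq_card/subsetP => _ /imsetP[x /fP[y -> [yB _]] ->]; apply: imset_f.
Qed.

Lemma sum_asym_le n (lt : rel 'I_n) :
  (forall r s, lt r s -> ~~ lt s r) ->
  2 * (\sum_(r < n) \sum_(s < n) lt s r) <= n * n.-1.
Proof.
move=> asym; rewrite mul2n -addnn {2}exchange_big -big_split /=.
have -> : n * n.-1 = \sum_(r < n) n.-1 by rewrite sum_nat_const card_ord.
apply: leq_sum => r _; rewrite -big_split /= (bigD1 r) //=.
have -> : lt r r = false by apply/negP => h; move: (asym _ _ h); rewrite h.
rewrite add0n; apply: (@leq_trans (\sum_(s < n | s != r) 1)).
  by apply: leq_sum => s _; case E : (lt s r) => //=; rewrite ?leq_b1 // (negPf (asym _ _ E)).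
by rewrite sum1_card cardC1 card_ord.
Qed.

(** Each counted pair uses up two elements, and for fixed [r] the disjoint sets [D r b] share out
    the [s] with [lt s r]. The other factor 2 is that of [sum_asym_le]. *)
Lemma card_crowded_le n (D : 'I_n -> 'I_n -> {set 'I_n}) (lt : rel 'I_n) :
  (forall r s, lt r s -> ~~ lt s r) ->
  (forall r b s, s \in D r b -> lt s r) ->
  (forall r b b' s, s \in D r b -> s \in D r b' -> b = b') ->
  4 * #|[set p | 1 < #|D p.1 p.2|]| <= n * n.-1.
Proof.
move=> asym Dlt Ddisj; apply: leq_trans (sum_asym_le asym).
rewrite (_ : 4 = 2 * 2) // -mulnA leq_mul2l /=.
rewrite -sum1_card big_distrr /=.
apply: (@leq_trans (\sum_(p : 'I_n * 'I_n) #|D p.1 p.2|)).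
  rewrite [leqRHS](bigID (fun p : 'I_n * 'I_n => p \in [set p | 1 < #|D p.1 p.2|])) /=.
  apply: leq_trans (leq_addr _ _).
  by apply: leq_sum => p; rewrite inE muln1.
rewrite -(pair_bigA _ (fun r b => #|D r b|)) /=; apply: leq_sum => r _.
rewrite (eq_bigr (fun b => \sum_(s < n) (s \in D r b))); last first.
  by move=> b _; rewrite -sum1_card big_mkcond.
rewrite exchange_big /=; apply: leq_sum => s _.
have [[b sDb]|noD] := pselect (exists b, s \in D r b).
  rewrite (bigD1 b) //= sDb (Dlt _ _ _ sDb) big1 // => b' b'b.
  by apply/eqP; rewrite eqb0; apply: contra b'b => sDb'; rewrite (Ddisj _ _ _ _ sDb sDb').
rewrite big1 // => b _; apply/eqP; rewrite eqb0.
by apply/negP => sDb; apply: noD; exists b.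
Qed.

(** Inclusion-exclusion: both sets have at most [n] elements, and the common element saves 1. The
    term [n == 0] replaces it when there are no pairs. *)
Lemma card_complU_ge n (A B : {set 'I_n * 'I_n}) :
  {in A &, injective fst} -> {in B &, injective snd} ->
  (0 < n -> exists p, (p \in A) && (p \in B)) ->
  n * n + 1 <= #|~: (A :|: B)| + 2 * n + (n == 0).
Proof.
move=> Ainj Binj meet.
have cA : #|A| <= n.
  by rewrite -(card_in_imset Ainj) -[leqRHS]card_ord max_card.
have cB : #|B| <= n.
  by rewrite -(card_in_imset Binj) -[leqRHS]card_ord max_card.
have := cardsC (A :|: B); rewrite card_prod !card_ord.
have := cardsUI A B.
case: n => [|n] in A B Ainj Binj meet cA cB *; first by lia.
have [p pAB] := meet isT.
have : 0 < #|A :&: B| by apply/card_gt0P; exists p; rewrite inE.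
by lia.
Qed.

Lemma bound_arith n g g4 g5 h :
  n * n + 1 <= g + 2 * n + (n == 0) -> g <= g4 + g5 + h ->
  4 * g4 <= n * n.-1 -> 4 * g5 <= n * n.-1 -> 2 * n ^ 2 + 3 * n <= 12 * h + 8.
Proof.
(* For n >= 4, 6(n-1)(n-2) >= 2n^2+3n-8, with equality at 4. The cases 2 and 3 need n(n-1)/4 rounded
   down. *)
by case: n => [|[|[|[|n]]]]; rewrite ?expnS ?expn0 /=; lia.
Qed.

End Counting.

(** * Height relative to the separating line, and angular orders *)

Section Separated.
Variables (R : realType) (ca cb cc : R).
Implicit Types r b c p q s w x y z : point R.

Definition height p : R := ca * p.1 + cb * p.2 + cc.

(** Laplace expansion of the determinant with rows (1, x, y, height), which vanishes because height
    is affine. *)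
Lemma orient_height4 r b x y :
  orient b x y * height r - orient r x y * height b
  + orient r b y * height x - orient r b x * height y = 0.
Proof. by rewrite /orient /height; ring. Qed.

(** The first two hypotheses put [x], [y], [z] strictly on one side of the level line through [c],
    where the angular order around [c] is transitive. *)
Lemma orient_trans c x y z :
  0 < (height x - height c) * (height y - height c) ->
  0 < (height z - height c) * (height y - height c) ->
  0 <= orient c x y -> 0 <= orient c y z ->
  0 < orient c x y + orient c y z -> 0 < orient c x z.
Proof.
move=> xy zy cxy cyz sum0.
have E : orient c x z * (height y - height c) ^+ 2 =
    orient c x y * ((height z - height c) * (height y - height c))
    + orient c y z * ((height x - height c) * (height y - height c)).
  by rewrite /orient /height; ring.
rewrite -(@pmulr_lgt0 _ ((height y - height c) ^+ 2)); last first.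
  rewrite lt_neqAle sqr_ge0 andbT eq_sym sqrf_eq0.
  by apply: contraTneq xy => ->; rewrite mulr0 ltxx.
rewrite E; have := mulr_ge0 cxy (ltW zy); have := mulr_ge0 cyz (ltW xy).
have [h|h] := ltrP 0 (orient c x y); first by have := mulr_gt0 h zy; lra.
have h' : 0 < orient c y z by lra.
by have := mulr_gt0 h' xy; lra.
Qed.

Lemma in_ccw_tri_height p q x w : in_ccw_tri p q x w ->
  (height q < height p -> height x < height p -> height w < height p) /\
  (height p < height q -> height p < height x -> height p < height w).
Proof.
move=> pqxw; have pqx := in_ccw_tri_gt0 pqxw.
have E : orient p q x * (height w - height p) =
    orient x p w * (height q - height p) + orient p q w * (height x - height p).
  by rewrite /orient /height; ring.
case/and3P: pqxw => pqw _ xpw; split=> hq hx.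
  rewrite -subr_lt0 -(pmulr_rlt0 _ pqx) E.
  have := pmulr_rlt0 (height q - height p) xpw.
  have := pmulr_rlt0 (height x - height p) pqw.
  by rewrite !subr_lt0 hq hx; lra.
rewrite -subr_gt0 -(pmulr_rgt0 _ pqx) E.
have := pmulr_rgt0 (height q - height p) xpw.
have := pmulr_rgt0 (height x - height p) pqw.
by rewrite !subr_gt0 hq hx; lra.
Qed.

(* Abscissa, on the line [height = 0], of its crossing with the line [p q]. *)
Definition crossing p q : R :=
  let v p := ca * p.2 - cb * p.1 in
  (height p * v q - height q * v p) / (height p - height q).

Hypothesis slope_neq0 : ca != 0 \/ cb != 0.

Lemma slope_gt0 : 0 < ca ^+ 2 + cb ^+ 2.
Proof.
rewrite lt_neqAle addr_ge0 ?sqr_ge0 // andbT eq_sym paddr_eq0 ?sqr_ge0 //.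
by rewrite !sqrf_eq0 negb_and; apply/orP.
Qed.

(** The crossings differ by a positive multiple of the orientation. Angular neighbours and extremes
    around a red point thus become extrema of a real function. *)
Lemma crossing_blue r b z : 0 < height r -> height b < 0 -> height z < 0 ->
  (crossing r z < crossing r b) = (0 < orient r b z).
Proof.
move=> r0 b0 z0.
have rb : 0 < height r - height b by lra.
have rz : 0 < height r - height z by lra.
have E : crossing r b - crossing r z =
    (height r * (ca ^+ 2 + cb ^+ 2) / ((height r - height b) * (height r - height z)))
      * orient r b z.
  move: rb rz => /gt_eqF/negbT rb /gt_eqF/negbT rz.
  move: rb rz; rewrite /crossing /orient /height => rb rz.
  by field; rewrite ?rb ?rz.
rewrite -subr_gt0 E pmulr_rgt0 // divr_gt0 ?mulr_gt0 //; exact: slope_gt0.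
Qed.

Lemma crossing_red r b s : 0 < height r -> height b < 0 -> 0 < height s ->
  (crossing s b < crossing r b) = (0 < orient r b s).
Proof.
move=> r0 b0 z0.
have rb : 0 < height r - height b by lra.
have rz : 0 < height s - height b by lra.
have E : crossing r b - crossing s b =
    (- height b * (ca ^+ 2 + cb ^+ 2) / ((height r - height b) * (height s - height b)))
      * orient r b s.
  move: rb rz => /gt_eqF/negbT rb /gt_eqF/negbT rz.
  move: rb rz; rewrite /crossing /orient /height => rb rz.
  by field; rewrite ?rb ?rz.
rewrite -subr_gt0 E pmulr_rgt0 // divr_gt0 ?mulr_gt0 ?oppr_gt0 //; exact: slope_gt0.
Qed.

End Separated.

(** * Balanced holes and the red-blue pair they determine *)

Section BalancedHoles.
Variables (R : realType) (n : nat) (pt : cidx n -> point R).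

Local Notation o i j k := (orient (pt i) (pt j) (pt k)).
Local Notation tri i j k z := (in_ccw_tri (pt i) (pt j) (pt k) (pt z)).
Local Notation verts r b x y := [set inl r; inr b; inr x; inl y].

Definition empty_tri (i j k : cidx n) := [forall z, ~~ tri i j k z].

(** [winding4] sums over the two triangles cut off by the diagonal [ik], so their emptiness leaves
    no interior point. The vertex set [cover E] serves to recover the red-blue pair. *)
Lemma balanced_4hole_diag i j k l :
  0 < o i j k -> 0 < o i k l ->
  count (@is_red n) [:: i; j; k; l] = 2%N ->
  empty_tri i j k -> empty_tri i k l ->
  exists2 E, E \in balanced_4holes pt & cover E = [set i; j; k; l].
Proof.
move=> ijk ikl cnt /forallP eijk /forallP eikl.
have ikj : o i k j < 0 by rewrite orient_swapr oppr_lt0.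
have simple := simple_quad_diag ikj ikl.
exists (quad_edges i j k l).
  rewrite inE; apply/existsP; exists (i, j, k, l); rewrite eqxx andbT.
  apply/asboolP; split=> //.
    by case: simple => un _ _ _; apply: (@map_uniq _ _ pt [:: i; j; k; l]).
  move=> z /interior_quad_tri[]; rewrite in_open_triE //; exact/negP.
apply/setP => z; rewrite /cover /quad_edges !bigcup_setU !big_set1 !inE.
by case: (z == i); case: (z == j); case: (z == k); case: (z == l).
Qed.

Hypothesis gp : general_position pt.

Lemma orient_neq0 i j k : i != j -> j != k -> i != k -> o i j k != 0.
Proof. by move=> /eqP ij /eqP jk /eqP ik; apply/eqP; apply: gp. Qed.

Variables ca cb cc : R.
Hypothesis slope_neq0 : ca != 0 \/ cb != 0.
Local Notation height := (height ca cb cc).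
Hypothesis red_gt0 : forall r : 'I_n, 0 < height (pt (inl r)).
Hypothesis blue_lt0 : forall b : 'I_n, height (pt (inr b)) < 0.

(* A convex quadrilateral with alternating colours has crossing monochromatic
   diagonals. *)
Lemma no_alternating_quad (r b x y : 'I_n) :
  0 < o (inl r) (inr b) (inr x) -> 0 < o (inl r) (inr b) (inl y) ->
  o (inl r) (inr x) (inl y) < 0 -> o (inr b) (inr x) (inl y) < 0 -> False.
Proof.
move=> rbx rby rxy bxy.
have := orient_height4 ca cb cc (pt (inl r)) (pt (inr b)) (pt (inr x)) (pt (inl y)).
have := pmulr_llt0 (o (inr b) (inr x) (inl y)) (red_gt0 r).
have := nmulr_lgt0 (o (inl r) (inr x) (inl y)) (blue_lt0 b).
have := nmulr_llt0 (o (inl r) (inr b) (inl y)) (blue_lt0 x).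
have := pmulr_lgt0 (o (inl r) (inr b) (inr x)) (red_gt0 y).
by rewrite rbx rby rxy bxy; lra.
Qed.

Lemma in_verts_red (r b x y z : 'I_n) :
  (inl z \in verts r b x y) = (z == r) || (z == y).
Proof.
by rewrite !inE (_ : inl z == inr b = false) // (_ : inl z == inr x = false) // !orbF.
Qed.

Lemma in_verts_blue (r b x y z : 'I_n) :
  (inr z \in verts r b x y) = (z == b) || (z == x).
Proof.
by rewrite !inE (_ : inr z == inl r = false) // (_ : inr z == inl y = false) // !orbF.
Qed.

(* The red-blue side of the convex hull of [V] having [V] on its left. *)
Definition left_bitangent (p : 'I_n * 'I_n) (V : {set cidx n}) :=
  exists x y : 'I_n, [/\ V = verts p.1 p.2 x y,
    0 < o (inl p.1) (inr p.2) (inr x) & 0 < o (inl p.1) (inr p.2) (inl y)].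

(** A second pair with one common endpoint would have a vertex on its right. With no common
    endpoint, the signs are those of [no_alternating_quad]. *)
Lemma left_bitangent_uniq p q V :
  left_bitangent p V -> left_bitangent q V -> p = q.
Proof.
case: p q => r b [r2 b2] [x [y [-> /= rbx rby]]] [x2 [y2 [/setP V2 /= rbx2 rby2]]].
have bx : b != x by apply: contraTneq rbx => ->; rewrite orient_id23 ltxx.
have ry : r != y by apply: contraTneq rby => ->; rewrite orient_id13 ltxx.
have Er2 : (r2 == r) || (r2 == y) by rewrite -(in_verts_red _ b x) V2 in_verts_red eqxx.
have Eb2 : (b2 == b) || (b2 == x) by rewrite -(in_verts_blue r _ _ y) V2 in_verts_blue eqxx.
have Er : (r == r2) || (r == y2) by rewrite -(in_verts_red _ b2 x2) -V2 in_verts_red eqxx.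
have Eb : (b == b2) || (b == x2) by rewrite -(in_verts_blue r2 _ _ y2) -V2 in_verts_blue eqxx.
case/orP: Er2 => /eqP Er2; case/orP: Eb2 => /eqP Eb2; subst r2 b2 => //.
- move: Eb; rewrite (negPf bx) => /eqP Eb; subst x2.
  by exfalso; move: rbx2; rewrite orient_swapr; lra.
- move: Er; rewrite (negPf ry) => /eqP Er; subst y2.
  have E : o (inl y) (inr b) (inl r) = - o (inl r) (inr b) (inl y).
    by rewrite /orient; ring.
  by exfalso; lra.
move: Eb Er; rewrite (negPf bx) (negPf ry) => /eqP Eb /eqP Er; subst x2 y2.
have Eb : o (inl y) (inr x) (inr b) = - o (inr b) (inr x) (inl y).
  by rewrite /orient; ring.
have Er : o (inl y) (inr x) (inl r) = - o (inl r) (inr x) (inl y).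
  by rewrite /orient; ring.
exfalso; apply: (no_alternating_quad rbx rby); lra.
Qed.

(** Opposite signs would put [y] in [rbx] or [x] in [rby]; two negative signs contradict
    [no_alternating_quad]. *)
Lemma quad_convex (r b x y : 'I_n) :
  0 < o (inl r) (inr b) (inr x) -> 0 < o (inl r) (inr b) (inl y) ->
  ~~ tri (inl r) (inr b) (inr x) (inl y) ->
  ~~ tri (inl r) (inr b) (inl y) (inr x) ->
  0 < o (inl r) (inr x) (inl y) /\ 0 < o (inr b) (inr x) (inl y).
Proof.
move=> rbx rby; rewrite /in_ccw_tri rbx rby /=.
have -> : o (inr x) (inl r) (inl y) = - o (inl r) (inr x) (inl y).
  by rewrite /orient; ring.
have -> : o (inr b) (inl y) (inr x) = - o (inr b) (inr x) (inl y).
  by rewrite /orient; ring.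
have -> : o (inl y) (inl r) (inr x) = o (inl r) (inr x) (inl y).
  by rewrite /orient; ring.
have ry : r != y by apply: contraTneq rby => ->; rewrite orient_id13 ltxx.
have bx : b != x by apply: contraTneq rbx => ->; rewrite orient_id23 ltxx.
have rxy : o (inl r) (inr x) (inl y) != 0 by apply: orient_neq0.
have bxy : o (inr b) (inr x) (inl y) != 0 by apply: orient_neq0.
move/lt_total: rxy => /orP[]; move/lt_total: bxy => /orP[] h1 h2.
- by case: (no_alternating_quad rbx rby).
- by rewrite !oppr_gt0 h1 h2.
- by rewrite !oppr_gt0 h1 h2.
- by [].
Qed.

Lemma empty_convex_quad (r b x y : 'I_n) :
  0 < o (inl r) (inr b) (inr x) -> 0 < o (inl r) (inr b) (inl y) ->
  empty_tri (inl r) (inr b) (inr x) -> empty_tri (inl r) (inr b) (inl y) ->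
  (forall z, 0 < o (inl r) (inr b) (inr z) -> empty_tri (inl r) (inr b) (inr z) ->
    ~~ (0 < o (inl r) (inr x) (inr z))) ->
  (forall z, 0 < o (inl r) (inr b) (inl z) -> empty_tri (inl r) (inr b) (inl z) ->
    ~~ (0 < o (inl y) (inr b) (inl z))) ->
  empty_tri (inl r) (inr x) (inl y).
Proof.
move=> rbx rby /forallP ex /forallP ey xmax ymax.
have [rxy bxy] := quad_convex rbx rby (ex _) (ey _).
apply/forallP => z0; apply/negP => z0P.
(* The point of [rxy] closest to the line [rb] has an empty triangle with [r] and [b], so its colour
   contradicts the extremality of [x] or [y]. *)
have [z zP zmin] := @Order.TotalTheory.arg_minP _ _ _ z0
   (fun z => tri (inl r) (inr x) (inl y) z) (fun z => o (inl r) (inr b) z) z0P.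
have xyr : 0 < o (inr x) (inl y) (inl r) by rewrite orient_rot.
have xyb : 0 < o (inr x) (inl y) (inr b) by rewrite orient_rot.
have yrb : 0 < o (inl y) (inl r) (inr b) by rewrite -orient_rot.
have bxr : 0 < o (inr b) (inr x) (inl r) by rewrite orient_rot.
have rbz : 0 < o (inl r) (inr b) z.
  by apply: (in_ccw_tri_orient zP); rewrite ?orient_id13; lra.
have bxz : 0 < o (inr b) (inr x) z.
  by apply: (in_ccw_tri_orient zP); rewrite ?orient_id23; lra.
case/and3P: (zP) => rxz xyz yrz.
(* A point of [rbz] lies in [rbx], which is empty, or in [rxy] and closer to [rb] than [z]. *)
have ez : empty_tri (inl r) (inr b) z.
  apply/forallP => w; apply/negP => wP.
  have xyw : 0 < o (inr x) (inl y) w by apply: (in_ccw_tri_orient wP); lra.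
  have yrw : 0 < o (inl y) (inl r) w.
    by apply: (in_ccw_tri_orient wP); rewrite ?orient_id23; lra.
  have bxw : 0 < o (inr b) (inr x) w.
    by apply: (in_ccw_tri_orient wP); rewrite ?orient_id13; lra.
  case/and3P: (wP) => rbw bzw zrw.
  have wx : inr x != w by apply: contraTneq xyw => <-; rewrite orient_id13 ltxx.
  have wr : inl r != w by apply: contraTneq rbw => <-; rewrite orient_id13 ltxx.
  have /lt_total/orP[rxw|rxw] : o (inl r) (inr x) w != 0 by apply: orient_neq0.
    case/negP: (ex w); apply/and3P; split=> //.
    by rewrite orient_swap; lra.
  have := zmin w; rewrite /in_ccw_tri rxw xyw yrw => /(_ isT).
  have := orient_split (pt (inl r)) (pt (inr b)) (pt z) (pt w).
  by lra.
case: z => z in zP zmin rbz bxz rxz xyz yrz ez *; last first.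
  by case/negP: (xmax _ rbz ez).
case/negP: (ymax _ rbz ez).
have yz : inl y != inl z :> cidx n.
  by apply: contraTneq xyz => ->; rewrite orient_id23 ltxx.
have E : o (inl y) (inr b) (inl z) = - o (inr b) (inl y) (inl z).
  by rewrite orient_swap.
have /lt_total/orP[|byz] : o (inl y) (inr b) (inl z) != 0 by apply: orient_neq0.
  move=> h; case/negP: (ey (inl z)); apply/and3P; split=> //; lra.
exact: byz.
Qed.

Lemma blue_left (r b z : 'I_n) :
  (0 < o (inl r) (inr b) (inr z)) =
  (crossing ca cb cc (pt (inl r)) (pt (inr z)) <
   crossing ca cb cc (pt (inl r)) (pt (inr b))).
Proof. by rewrite crossing_blue. Qed.

Lemma red_left (r b z : 'I_n) :
  (0 < o (inl r) (inr b) (inl z)) =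
  (crossing ca cb cc (pt (inl z)) (pt (inr b)) <
   crossing ca cb cc (pt (inl r)) (pt (inr b))).
Proof. by rewrite crossing_red. Qed.

(* Red points that [r] sees between [b] and the next blue point to its left. *)
Definition red_behind (r b : 'I_n) : {set 'I_n} :=
  [set s | [&& height (pt (inl s)) < height (pt (inl r)),
    0 < o (inl r) (inr b) (inl s) &
    [forall z, (0 < o (inl r) (inr b) (inr z)) ==>
               (0 < o (inl r) (inl s) (inr z))]]].

Definition blue_behind (b r : 'I_n) : {set 'I_n} :=
  [set s | [&& height (pt (inr b)) < height (pt (inr s)),
    0 < o (inl r) (inr b) (inr s) &
    [forall z, (0 < o (inl r) (inr b) (inl z)) ==>
               (0 < o (inr b) (inl z) (inr s))]]].

(** If [b'] is left of [rb], the condition for [b] applied to [b'] puts [s] to the right of [rb'];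
    the other case is symmetric. *)
Lemma red_behind_disjoint r b b' s :
  s \in red_behind r b -> s \in red_behind r b' -> b = b'.
Proof.
rewrite !inE => /and3P[_ rbs /forallP bmin] /and3P[_ rb's /forallP b'min].
apply/eqP; apply: contraT => bb'.
have /lt_total/orP[h|h] : o (inl r) (inr b) (inr b') != 0 by apply: orient_neq0.
  have := implyP (b'min b); rewrite orient_swapr oppr_gt0 => /(_ h).
  by rewrite orient_swapr; lra.
by have := implyP (bmin b') h; rewrite orient_swapr; lra.
Qed.

Lemma blue_behind_disjoint b r r' s :
  s \in blue_behind b r -> s \in blue_behind b r' -> r = r'.
Proof.
rewrite !inE => /and3P[_ rbs /forallP rmin] /and3P[_ r'bs /forallP r'min].
apply/eqP; apply: contraT => rr'.
have /lt_total/orP[h|h] : o (inl r) (inr b) (inl r') != 0 by apply: orient_neq0.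
  have h' : 0 < o (inl r') (inr b) (inl r).
    by rewrite orient_rot orient_swapr; lra.
  by have := implyP (r'min r) h'; rewrite orient_swap; lra.
by have := implyP (rmin r') h; rewrite orient_swap; lra.
Qed.

Lemma card_red_behind :
  (4 * #|[set p : 'I_n * 'I_n | 1 < #|red_behind p.1 p.2|]| <= n * n.-1)%N.
Proof.
apply: (@card_crowded_le _ _ (fun s r => height (pt (inl s)) < height (pt (inl r)))).
- by move=> r s; rewrite -leNgt => /ltW.
- by move=> r b s; rewrite inE => /and3P[].
- exact: red_behind_disjoint.
Qed.

Lemma card_blue_behind :
  (4 * #|[set p : 'I_n * 'I_n | 1 < #|blue_behind p.1 p.2|]| <= n * n.-1)%N.
Proof.
apply: (@card_crowded_le _ _ (fun s b => height (pt (inr b)) < height (pt (inr s)))).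
- by move=> r s; rewrite -leNgt => /ltW.
- by move=> r b s; rewrite inE => /and3P[].
- exact: blue_behind_disjoint.
Qed.

(** * Angular neighbours and the hole of a good pair *)

Lemma exists_next_blue (r b z0 : 'I_n) : 0 < o (inl r) (inr b) (inr z0) ->
  exists2 x, 0 < o (inl r) (inr b) (inr x) &
    forall z, tri (inl r) (inr b) (inr x) z ->
      exists2 s, z = inl s & s \in red_behind r b.
Proof.
move=> rbz0.
(* Turning left about [r] lowers the crossing, so the largest one left of [rb] belongs to the next
   blue point. *)
have [x rbx xmax] := @Order.TotalTheory.arg_maxP _ _ _ z0
  (fun z => 0 < o (inl r) (inr b) (inr z))
  (fun z => crossing ca cb cc (pt (inl r)) (pt (inr z))) rbz0.
have xle z : 0 < o (inl r) (inr b) (inr z) -> 0 <= o (inl r) (inr x) (inr z).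
  move=> /xmax /=; rewrite leNgt -blue_left => h.
  by rewrite -[_ <= _]negbK -ltNge -oppr_gt0 -orient_swapr.
exists x => // -[s|z] /[dup] sP /and3P[rbs bxs xrs]; last first.
  by have := xle z rbs; move: xrs; rewrite orient_swap; lra.
exists s => //; rewrite inE rbs /=.
have hs : height (pt (inl s)) < height (pt (inl r)).
  have [h _] := in_ccw_tri_height ca cb cc sP.
  by apply: h; apply: lt_trans (blue_lt0 _) (red_gt0 _).
rewrite hs; apply/forallP => z; apply/implyP => /xle rxz.
have hz w : height (pt (inr w)) - height (pt (inl r)) < 0.
  by have := blue_lt0 w; have := red_gt0 r; lra.
have rsx : 0 < o (inl r) (inl s) (inr x) by rewrite orient_rot.
(* Around [r], and below it, [s] comes before [x] and [x] no later than [z]. *)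
apply: (@orient_trans _ ca cb cc _ _ (pt (inr x)) _ _ _ (ltW rsx) rxz); last lra.
  by rewrite nmulr_rgt0 // subr_lt0.
by rewrite nmulr_rgt0.
Qed.

Lemma exists_next_red (r b z0 : 'I_n) : 0 < o (inl r) (inr b) (inl z0) ->
  exists2 y, 0 < o (inl r) (inr b) (inl y) &
    forall z, tri (inl r) (inr b) (inl y) z ->
      exists2 s, z = inr s & s \in blue_behind b r.
Proof.
move=> rbz0.
have [y rby ymax] := @Order.TotalTheory.arg_maxP _ _ _ z0
  (fun z => 0 < o (inl r) (inr b) (inl z))
  (fun z => crossing ca cb cc (pt (inl z)) (pt (inr b))) rbz0.
have yle z : 0 < o (inl r) (inr b) (inl z) -> 0 <= o (inr b) (inl z) (inl y).
  move=> /ymax /=; rewrite leNgt -red_left => h.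
  rewrite orient_rot leNgt; apply: contra h.
  by rewrite -oppr_gt0 -orient_swapr -orient_rot.
exists y => // -[z|s] /[dup] sP /and3P[rbs bys yrs].
  by have := yle z rbs; move: bys; rewrite orient_swapr; lra.
exists s => //; rewrite inE rbs /=.
have hs : height (pt (inr b)) < height (pt (inr s)).
  have sP' : tri (inr b) (inl y) (inl r) (inr s) by apply/and3P.
  have [_ h] := in_ccw_tri_height ca cb cc sP'.
  by apply: h; apply: lt_trans (blue_lt0 _) (red_gt0 _).
rewrite hs; apply/forallP => z; apply/implyP => /yle bzy.
have hz w : 0 < height (pt (inl w)) - height (pt (inr b)).
  by have := blue_lt0 b; have := red_gt0 w; lra.
apply: (@orient_trans _ ca cb cc _ _ (pt (inl y)) _ _ _ bzy (ltW bys)); last lra.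
  by rewrite mulr_gt0.
by rewrite mulr_gt0 // subr_gt0.
Qed.

Lemma bitangent_hole (r b x0 y0 : 'I_n) :
  0 < o (inl r) (inr b) (inr x0) -> 0 < o (inl r) (inr b) (inl y0) ->
  (#|red_behind r b| <= 1)%N -> (#|blue_behind b r| <= 1)%N ->
  exists2 E, E \in balanced_4holes pt & left_bitangent (r, b) (cover E).
Proof.
move=> /exists_next_blue[x rbx xtri] /exists_next_red[y rby ytri].
move=> /card_le1_eqP redb /card_le1_eqP blueb.
(* The only red point [s] in [rbx] gives the hole [rbsx], reflex at [s] and cut by [rs]: a point in
   either half would be a second element of [red_behind]. *)
have [/forallP xe|/forallPn[z]] := boolP (empty_tri (inl r) (inr b) (inr x)); last first.
  rewrite negbK => /[dup] /xtri[s -> sb] sP; have /and3P[rbs bxs xrs] := sP.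
  have rsx : 0 < o (inl r) (inl s) (inr x) by rewrite orient_rot.
  have [||E EH EV] := @balanced_4hole_diag (inl r) (inr b) (inl s) (inr x) rbs rsx erefl.
  - apply/forallP => w; apply/negP => wP.
    have wP' : tri (inl r) (inr b) (inr x) w.
      have bxr : 0 < o (inr b) (inr x) (inl r) by rewrite orient_rot.
      have xrb : 0 < o (inr x) (inl r) (inr b) by rewrite -orient_rot.
      apply/and3P; split; first by case/and3P: wP.
        by apply: (in_ccw_tri_orient wP); rewrite ?orient_id13; lra.
      by apply: (in_ccw_tri_orient wP); rewrite ?orient_id23; lra.
    have [w' ww' wb] := xtri w wP'; case/and3P: wP.
    by rewrite ww' (redb _ _ wb sb) orient_id23 ltxx.
  - apply/forallP => w; apply/negP => wP.
    have wP' : tri (inl r) (inr b) (inr x) w.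
      have bxr : 0 < o (inr b) (inr x) (inl r) by rewrite orient_rot.
      apply/and3P; split; last by case/and3P: wP.
        by apply: (in_ccw_tri_orient wP); rewrite ?orient_id13; lra.
      by apply: (in_ccw_tri_orient wP); rewrite ?orient_id23; lra.
    have [w' ww' wb] := xtri w wP'; case/and3P: wP.
    by rewrite ww' (redb _ _ wb sb) orient_id23 ltxx.
  exists E => //; exists x, s; split=> //=; rewrite EV.
  by rewrite setUAC.
have [/forallP ye|/forallPn[z]] := boolP (empty_tri (inl r) (inr b) (inl y)); last first.
  rewrite negbK => /[dup] /ytri[s -> sb] sP; have /and3P[rbs bys yrs] := sP.
  have bsr : 0 < o (inr b) (inr s) (inl r) by rewrite orient_rot.
  have [||E EH EV] := @balanced_4hole_diag (inr b) (inl y) (inr s) (inl r) bys bsr erefl.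
  - apply/forallP => w; apply/negP => wP.
    have wP' : tri (inl r) (inr b) (inl y) w.
      have yrb : 0 < o (inl y) (inl r) (inr b) by rewrite -orient_rot.
      apply/and3P; split; [|by case/and3P: wP|].
        by apply: (in_ccw_tri_orient wP); rewrite ?orient_id23; lra.
      by apply: (in_ccw_tri_orient wP); rewrite ?orient_id13; lra.
    have [w' ww' wb] := ytri w wP'; case/and3P: wP.
    by rewrite ww' (blueb _ _ wb sb) orient_id23 ltxx.
  - apply/forallP => w; apply/negP => wP.
    have wP' : tri (inl r) (inr b) (inl y) w.
      have yrb : 0 < o (inl y) (inl r) (inr b) by rewrite -orient_rot.
      have byr : 0 < o (inr b) (inl y) (inl r) by rewrite orient_rot.
      apply/and3P; split; [by case/and3P: wP| |].
        by apply: (in_ccw_tri_orient wP); rewrite ?orient_id13; lra.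
      by apply: (in_ccw_tri_orient wP); rewrite ?orient_id23; lra.
    have [w' ww' wb] := ytri w wP'; case/and3P: wP.
    by rewrite ww' (blueb _ _ wb sb) orient_id23 ltxx.
  exists E => //; exists s, y; split=> //=; rewrite EV.
  by apply/setP => w; rewrite !inE; do 4 case: (w == _).
(* Among points with empty triangles, the least crossings select the last blue point in the turn
   about [r] and the last red one about [b]; [x] and [y] show that candidates exist. *)
have /(_ x)[|x1 /andP[rbx1 ex1] x1max] := @Order.TotalTheory.arg_minP _ _ _ _
  (fun z => (0 < o (inl r) (inr b) (inr z)) && empty_tri (inl r) (inr b) (inr z))
  (fun z => crossing ca cb cc (pt (inl r)) (pt (inr z))).
  by rewrite rbx; apply/forallP.
have /(_ y)[|y1 /andP[rby1 ey1] y1max] := @Order.TotalTheory.arg_minP _ _ _ _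
  (fun z => (0 < o (inl r) (inr b) (inl z)) && empty_tri (inl r) (inr b) (inl z))
  (fun z => crossing ca cb cc (pt (inl z)) (pt (inr b))).
  by rewrite rby; apply/forallP.
have [rxy _] := quad_convex rbx1 rby1 (forallP ex1 _) (forallP ey1 _).
have [||E EH EV] := @balanced_4hole_diag (inl r) (inr b) (inr x1) (inl y1) rbx1 rxy erefl.
- by [].
- apply: (@empty_convex_quad r b x1 y1) => // z rbz ez.
    by rewrite blue_left -leNgt x1max // rbz.
  by rewrite red_left -leNgt y1max // rbz.
by exists E => //; exists x1, y1.
Qed.

(** * Counting the good pairs *)

Lemma card_balanced_4holes_ge :
  (2 * n ^ 2 + 3 * n <= 12 * #|balanced_4holes pt| + 8)%N.
Proof.
pose noblue := [set p : 'I_n * 'I_n |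
  [forall z, ~~ (0 < o (inl p.1) (inr p.2) (inr z))]].
pose nored := [set p : 'I_n * 'I_n |
  [forall z, ~~ (0 < o (inl p.1) (inr p.2) (inl z))]].
pose crowdr := [set p : 'I_n * 'I_n | (1 < #|red_behind p.1 p.2|)%N].
pose crowdb := [set p : 'I_n * 'I_n | (1 < #|blue_behind p.2 p.1|)%N].
have crowdbE : #|crowdb| = #|[set p : 'I_n * 'I_n | (1 < #|blue_behind p.1 p.2|)%N]|.
  have swapI : injective (fun p : 'I_n * 'I_n => (p.2, p.1)).
    by move=> [? ?] [? ?] [-> ->].
  rewrite -(card_imset _ swapI); apply: eq_card => -[b r]; rewrite !inE /=.
  apply/imsetP/idP => [[[r' b'] + [-> ->]]|h]; first by rewrite inE.
  by exists (r, b); rewrite ?inE.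
apply: (@bound_arith n #|~: (noblue :|: nored)| #|crowdr| #|crowdb|).
- apply: card_complU_ge.
  (* Of two blue points, one lies left of the ray from [r] to the other, so [r] occurs at most once
     in [noblue]. *)
  + move=> [r b] [r' b']; rewrite !inE /= => /forallP h /forallP h' rr'.
    subst r'; congr pair; apply/eqP; apply: contraT => bb'.
    have /lt_total/orP[|k] : o (inl r) (inr b) (inr b') != 0 by apply: orient_neq0.
      by rewrite -oppr_gt0 -orient_swapr (negPf (h' b)).
    by move: (h b'); rewrite k.
  + move=> [r b] [r' b']; rewrite !inE /= => /forallP h /forallP h' bb'.
    subst b'; congr pair; apply/eqP; apply: contraT => rr'.
    have /lt_total/orP[|k] : o (inl r) (inr b) (inl r') != 0 by apply: orient_neq0.
      rewrite -oppr_gt0 -orient_swapr -orient_rot => k.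
      by move: (h' r); rewrite k.
    by move: (h r'); rewrite k.
  (* At the pair of least crossing, a point on the left would give a smaller crossing. *)
  + move=> n0; pose p0 := (Ordinal n0, Ordinal n0).
    have [p _ pmin] := @Order.TotalTheory.arg_minP _ _ _ p0 xpredT
      (fun p => crossing ca cb cc (pt (inl p.1)) (pt (inr p.2))) isT.
    exists p; rewrite !inE; apply/andP; split; apply/forallP => z.
      by rewrite blue_left -leNgt (pmin (p.1, z)).
    by rewrite red_left -leNgt (pmin (z, p.2)).
- pose good := ~: (noblue :|: nored) :\: (crowdr :|: crowdb).
  have : (#|good| <= #|balanced_4holes pt|)%N.
    apply: (@card_le_rel _ _ _ _ (fun p E => left_bitangent p (cover E))).
      move=> [r b]; rewrite !inE /= !negb_or -!leqNgt.
      case/andP=> /andP[cr cb'] /andP[/forallPn[x /negPn rbx] /forallPn[y /negPn rby]].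
      exact: bitangent_hole rbx rby cr cb'.
    by move=> p q E; apply: left_bitangent_uniq.
  move=> leH; apply: (@leq_trans (#|crowdr :|: crowdb| + #|good|)%N).
    by rewrite -[leqLHS](cardsID (crowdr :|: crowdb)) leq_add2r subset_leq_card ?subsetIr.
  by rewrite leq_add // -cardsUI leq_addr.
- exact: card_red_behind.
- by rewrite crowdbE card_blue_behind.
Qed.

End BalancedHoles.

Theorem theorem2 (R : realType) (n : nat) (pt : cidx n -> point R) :
  injective pt ->
  general_position pt ->
  lin_separable pt ->
  ((2 * (n%:Z) ^+ 2 + 3 * n%:Z - 8)%:~R / 12 : R) <= (#|balanced_4holes pt|)%:R.
Proof.
move=> _ gp [a [b [c [ab [red blue]]]]].
have := @card_balanced_4holes_ge R n pt gp a b c ab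
  (fun r => red (inl r) isT) (fun b => blue (inr b) isT).
rewrite ler_pdivrMr // -(ler_nat R) -mulnn !natrD !natrM.
rewrite rmorphB rmorphD !rmorphM /= -!pmulrn.
by lra.
Qed.
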